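(* Let $p<q$ be primes and $\xi=\log q/\log p$. Assume $(a,b)$ is an upper or lower best approximation for $\xi$ and $\alpha=p^a/q^b$. If $S\subseteq\mathcal V(\alpha)$ is an infimum set for $\alpha$, then $\mathrm{Vert}(S)$ is also an infimum set for $\alpha$.
   Context: $\mathbb N_0=\{0,1,2,\dots\}$, $\mathcal N=\{(a,b)\in\mathbb N_0^2:(a,b)\neq(0,0)\}$, $\mathcal G=\{(a,b)\in\mathcal N:\gcd(a,b)=1\}$ (convention $\gcd(a,0)=a$; $a/0=\infty$ for $a\in\mathbb N$). For positive irrational $\xi$: $\mathcal U(\xi)=\{(a,b)\in\mathcal N:a>b\xi\}$, $\mathcal L(\xi)=\{(a,b)\in\mathcal N:a<b\xi\}$, $\mathcal U_1(\xi)=\{(a,b)\in\mathcal U(\xi): a/b=\min\{m/n:(m,n)\in\mathcal U(\xi),\ m\le a\}\}$, $\mathcal L_2(\xi)=\{(a,b)\in\mathcal L(\xi): a/b=\max\{m/n:(m,n)\in\mathcal L(\xi),\ n\le b\}\}$; upper (resp. lower) best approximations are elements of $\mathcal G\cap\mathcal U_1(\xi)$ (resp. $\mathcal G\cap\mathcal L_2(\xi)$). Let $(a_1,b_1),\dots,(a_N,b_N)$ be the complete list of upper or lower best approximations to $\xi$ with $a_n\le a$, $b_n\le b$ (ordered by $b_n$, ties by $a_n$); $T_\alpha:\mathbb R^N\to\mathbb R^2$ is the linear map with matrix rows $(a_1,\dots,a_N)$, $(b_1,\dots,b_N)$, and $\mathcal V(\alpha)=\{\mathbf x\in\mathbb N_0^N:T_\alpha(\mathbf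 x)=(a,b)^T\}$. For $\mathbf x=(x_1,\dots,x_N)^T\in\mathcal V(\alpha)$ and $t>0$, $f_{\mathbf x}(t)=\left(\sum_{n=1}^N x_n\, m(p^{a_n}/q^{b_n})^t\right)^{1/t}$, where for a rational $r/s$ in lowest terms $m(r/s)=\log\max\{|r|,|s|\}$ (the Mahler measure). For a nonzero algebraic $\beta$ with Mahler measure $m(\beta)=[\mathbb Q(\beta):\mathbb Q]h(\beta)$ ($h$ the absolute logarithmic Weil height), $m_t(\alpha)=\inf(\sum_{k=1}^M m(\alpha_k)^t)^{1/t}$ over all tuples $(\alpha_1,\dots,\alpha_M)$ of nonzero algebraic numbers with product $\alpha$. A subset $S\subseteq\mathcal V(\alpha)$ is an infimum set for $\alpha$ if $m_t(\alpha)=\min\{f_{\mathbf x}(t):\mathbf x\in S\}$ for all $t>0$. For finite $S\subseteq\mathbb R^N$, $\mathrm{Conv}(S)=\{\sum_{\mathbf x\in S}c_{\mathbf x}\mathbf x: c_{\mathbf x}\ge0,\ \sum c_{\mathbf x}=1\}$, and $\mathrm{Vert}(S)$ is the set of $\mathbf x\in S$ with $\mathbf x\notin\mathrm{Conv}(S\setminus\{\mathbf x\})$. *)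

(* Defs.v *)
From HB Require Import structures.
From mathcomp Require Import all_boot all_order all_algebra all_field.
From mathcomp Require Import all_classical all_reals all_analysis.
From mathcomp Require Import finmap complex.

Set Implicit Arguments.
Unset Strict Implicit.
Unset Printing Implicit Defensive.
Import Order.TTheory GRing.Theory Num.Theory.

Local Open Scope classical_set_scope.
Local Open Scope ring_scope.

Definition is_min d (T : porderType d) (A : set T) (x : T) :=
  A x /\ lbound A x.

Definition is_max d (T : porderType d) (A : set T) (x : T) :=
  A x /\ ubound A x.

(* The pair (a, b) is the formal fraction a / b; pairs are not reduced. *)
Section BestApproximations.
Variables (R : realType) (xi : R).

Definition calN : set (nat * nat) := [set u | u <> (0%N, 0%N)].

Definition calG : set (nat * nat) := [set u | calN u /\ gcdn u.1 u.2 = 1%N].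

Definition frac_val (u : nat * nat) : \bar R :=
  if u.2 == 0%N then +oo%E else (u.1%:R / u.2%:R)%:E.

Definition calU : set (nat * nat) :=
  [set u | calN u /\ u.2%:R * xi < u.1%:R].

Definition calL : set (nat * nat) :=
  [set u | calN u /\ u.1%:R < u.2%:R * xi].

Definition calU1 : set (nat * nat) :=
  [set u | calU u /\
    is_min [set frac_val v | v in [set v | calU v /\ (v.1 <= u.1)%N]] (frac_val u)].

Definition calL2 : set (nat * nat) :=
  [set u | calL u /\
    is_max [set frac_val v | v in [set v | calL v /\ (v.2 <= u.2)%N]] (frac_val u)].

Definition upper_best_approx : set (nat * nat) := calG `&` calU1.

Definition lower_best_approx : set (nat * nat) := calG `&` calL2.

Definition best_approx : set (nat * nat) :=
  upper_best_approx `|` lower_best_approx.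

(* The comprehension runs through j = 0, ..., b in the outer loop and through
   i = 0, ..., a in the inner one, so the list is ordered by the second
   component, with ties ordered by the first. *)
Definition best_approx_list (a b : nat) : seq (nat * nat) :=
  [seq u <- [seq (i, j) | j <- iota 0 b.+1, i <- iota 0 a.+1]
     | `[< best_approx u >]].

End BestApproximations.

Section WeilHeight.
Variables (R : realType) (K : fieldExtType rat).

(* The archimedean places of the number field K, a pair of conjugate
   embeddings being one place of local degree 2. *)
Definition complex_embeddings : set (K -> R[i]) :=
  [set s : K -> R[i] | exists f : {rmorphism K -> R[i]}, s = f].

(* The nonarchimedean places of K: the surjective discrete valuations
   v : K^* -> Z. The value v 0 = 0 only makes each place a single function;
   it stands for v 0 = +oo. *)
Definition finite_places : set (K -> int) :=
  [set v | [/\ v 0 = 0,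
     {in [pred x | x != 0] &, {morph v : x y / x * y >-> x + y}},
     (forall x y, x != 0 -> y != 0 -> x + y != 0 ->
        Num.min (v x) (v y) <= v (x + y)) &
     exists2 x, x != 0 & v x = 1]].

(* The residue classes of the valuation ring modulo its maximal ideal. *)
Definition residue_field (v : K -> int) : set (set K) :=
  [set [set y | y = x \/ 0 < v (y - x)] | x in [set x | 0 <= v x]].

Definition residue_card (v : K -> int) : nat := #|` fset_set (residue_field v)|.

(* (1/[K:Q]) * \sum_w [K_w : Q_w] log max(1, |x|_w), the sum being over all the
   places w of K, with |.|_w extending the usual absolute value of Q. At a
   finite place |x|_w ^ [K_w : Q_w] = N_v ^ - v(x), for N_v the cardinality of
   the residue field; only finitely many v give a nonzero term. *)
Definition weil_height (x : K) : R :=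
  (\dim {:K})%:R^-1 *
  (\sum_(s \in complex_embeddings) ln (Num.max 1 (Normc.normc (s x))) +
   \sum_(v \in finite_places)
      ln (Num.max 1 ((residue_card v)%:R ^ (- v x) : R))).

End WeilHeight.

(* num_field_exists [:: beta] provides K together with an embedding into algC
   and the list [:: x] such that x is mapped to beta and K = Q(x). *)
Definition mahler (R : realType) (beta : algC) : R :=
  let: existT K (existT _ (exist2 s _ _)) := num_field_exists [:: beta] in
  (\dim {:K})%:R * weil_height R (head 0 s).

(* numq and denq are the numerator and denominator in lowest terms. *)
Definition mahler_rat (R : realType) (r : rat) : R :=
  ln (maxn `|numq r|%N `|denq r|%N)%:R.

Definition metric_mahler (R : realType) (t : R) (alpha : algC) : R :=
  inf [set (\sum_(beta <- s) mahler R beta `^ t) `^ t^-1 | s in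
        [set s : seq algC | 0 \notin s /\ \prod_(beta <- s) beta = alpha]].

Section ConvexHull.
Variables (R : realType) (V : lmodType R).

(* On a finite set S, both \sum_(x \in S) are ordinary finite sums. *)
Definition Conv (S : set V) : set V :=
  [set y | exists c : V -> R,
     [/\ forall x, S x -> 0 <= c x,
         \sum_(x \in S) c x = 1 &
         y = \sum_(x \in S) c x *: x]].

Definition Vert (S : set V) : set V :=
  [set x | S x /\ ~ Conv (S `\ x) x].

End ConvexHull.

Section InfimumSets.
Variables (R : realType) (p q : nat) (xi : R) (a b : nat).

Let bal := best_approx_list xi a b.
Let N := size bal.

Definition frac_pq (u : nat * nat) : rat := p%:R ^+ u.1 / q%:R ^+ u.2.

Definition approx_at (n : 'I_N) : nat * nat := nth (0%N, 0%N) bal n.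

Definition T_alpha : 'M[R]_(2, N) :=
  \matrix_(i, n) (if i == 0 then (approx_at n).1 else (approx_at n).2)%:R.

Definition calV : set 'cV[R]_N :=
  [set x : 'cV[R]_N | (forall n, x n 0 \is a Num.nat) /\
           T_alpha *m x = \col_i (if i == 0 then a else b)%:R].

Definition f_pt (x : 'cV[R]_N) (t : R) : R :=
  (\sum_(n < N) x n 0 * mahler_rat R (frac_pq (approx_at n)) `^ t) `^ t^-1.

Definition infimum_set (S : set 'cV[R]_N) : Prop :=
  S `<=` calV /\
  forall t : R, 0 < t ->
    is_min [set f_pt x t | x in S] (metric_mahler t (ratr (frac_pq (a, b)))).

End InfimumSets.

(* Main.v *)
Require Import Defs.
From HB Require Import structures.
From mathcomp Require Import all_boot all_order all_algebra all_field.
From mathcomp Require Import all_classical all_reals all_analysis.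
From mathcomp Require Import finmap lra.

(** Since all (a_n, b_n) are nonzero, V(alpha) is finite. For fixed t the
   quantity f_x(t)^t is linear in x, so it remains to see that a linear form on
   a finite set S attains its minimum at a point of Vert(S). Among the
   minimizers choose y of maximal Euclidean norm: if y were a convex combination
   of other points of S, only minimizers x could occur in it, and
   2 <x, y> = |x|^2 + |y|^2 - |x - y|^2 < 2 |y|^2 for these, which contradicts
   that |y|^2 is the corresponding convex combination of the <x, y>. *)

Import Order.TTheory GRing.Theory Num.Theory.
Local Open Scope classical_set_scope.
Local Open Scope ring_scope.

Lemma finite_argmin {d} {R : orderType d} {T : choiceType} (A : set T)
    (f : T -> R) : finite_set A -> A !=set0 ->
  exists2 x, A x & forall y, A y -> (f x <= f y)%O.
Proof.
move=> finA [x0 Ax0].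
have memA z : (z \in fset_set A) = (z \in A) by rewrite in_fset_set.
have x0A : x0 \in fset_set A by rewrite memA; apply: mem_set.
have [x _ xmin] := @Order.TotalTheory.arg_minP _ _ _ [` x0A]%fset xpredT
  (fun z : fset_set A => f (val z)) isT.
exists (val x); first by apply: set_mem; rewrite -memA; apply: valP.
move=> y Ay; have yA : y \in fset_set A by rewrite memA; apply: mem_set.
exact: (xmin [` yA]%fset).
Qed.

Section LinearForms.
Context {R : realType} {N : nat}.
Implicit Types (S : set 'cV[R]_N) (c x y : 'cV[R]_N).

Definition dotp c x : R := \sum_n x n 0 * c n 0.

Lemma dotp_is_linear c : linear (dotp c).
Proof.
move=> k x y; rewrite /dotp scaler_sumr -big_split /=.
by apply: eq_bigr => n _; rewrite !mxE mulrDl -mulrA.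
Qed.

HB.instance Definition _ c :=
  GRing.isLinear.Build R 'cV[R]_N R *:%R (dotp c) (dotp_is_linear c).

Lemma dotpC x y : dotp x y = dotp y x.
Proof. by apply: eq_bigr => n _; rewrite mulrC. Qed.

Lemma dotp_gt0 x : x != 0 -> 0 < dotp x x.
Proof.
have sq_ge0 n : true -> 0 <= x n 0 * x n 0 by rewrite -expr2 sqr_ge0.
move=> x_neq0; rewrite lt_def sumr_ge0// andbT.
apply: contra_neq x_neq0 => /eqP; rewrite psumr_eq0// => /allP x0.
apply/matrixP => n j; rewrite ord1 mxE.
by have := x0 n (mem_index_enum n); rewrite /= mulf_eq0 orbb => /eqP.
Qed.

Lemma dotp_lt_norm x y : x != y -> dotp x x <= dotp y y ->
  dotp y x < dotp y y.
Proof.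
rewrite -subr_eq0 => /dotp_gt0.
by rewrite linearB/= dotpC (dotpC _ y) !linearB/= (dotpC x y); lra.
Qed.

Lemma Vert_argmin S c x : finite_set S -> S x ->
  exists2 y, Vert S y & dotp c y <= dotp c x.
Proof.
move=> finS Sx.
have [m Sm mmin] := finite_argmin _ (dotp c) finS (ex_intro _ x Sx).
pose M := [set z | S z /\ dotp c z = dotp c m].
have finM : finite_set M by apply: sub_finite_set finS => z [].
(* Minimizing [- dotp z z] over the set [M] of minimizers of [dotp c] picks one of maximal norm. *)
have [y [Sy cyE] ymax] := finite_argmin _ (fun z => - dotp z z) finM
  (ex_intro _ m (conj Sm erefl)).
exists y; last by rewrite cyE mmin.
split=> // -[k [k_ge0 k_sum yE]].
have finD : finite_set (S `\ y) by apply: sub_finite_set finS => z [].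
rewrite fsbig_finite//= in k_sum; rewrite fsbig_finite//= in yE.
(* Apply [g] to the convex combination [yE] and subtract [g y], using that the weights sum to 1. *)
have comb (g : {linear 'cV[R]_N -> R}) :
    \sum_(z <- fset_set (S `\ y)) k z * (g z - g y) = 0.
  under eq_bigr do rewrite mulrBr.
  rewrite sumrB -mulr_suml k_sum mul1r.
  rewrite [in g y]yE linear_sum/=.
  by apply/eqP; rewrite subr_eq0; apply/eqP/eq_bigr => z _; rewrite linearZ.
have memD z : z \in fset_set (S `\ y) -> S z /\ z != y.
  by rewrite in_fset_set// => /set_mem[Sz /eqP].
have {}k_ge0 z : z \in fset_set (S `\ y) -> 0 <= k z.
  by rewrite in_fset_set// => /set_mem/k_ge0.
(* As [y] minimizes [dotp c] on [S], all terms of [comb (dotp c)] are nonnegative; their sum is 0,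
   so each vanishes. *)
have c_terms z : z \in fset_set (S `\ y) -> k z != 0 -> dotp c z = dotp c y.
  move=> zS kz; have /= /eqP := comb (dotp c).
  rewrite big_seq psumr_eq0 => [/allP/(_ z zS)|w wS].
    by rewrite zS /= mulf_eq0 (negPf kz) subr_eq0 => /eqP.
  have [Sw _] := memD w wS.
  by rewrite mulr_ge0 ?k_ge0// subr_ge0 cyE mmin.
(* Points of nonzero weight lie in [M], so their norm is at most that of [y]. The terms of
   [comb (dotp y)] are then all nonpositive, and negative wherever the weight is nonzero. *)
have k0 z : z \in fset_set (S `\ y) -> k z = 0.
  have y_terms w : w \in fset_set (S `\ y) -> k w != 0 -> dotp y w < dotp y y.
    move=> wS kw; have [Sw wy] := memD w wS; apply: dotp_lt_norm => //.
    by rewrite -lerN2; apply: ymax; split=> //; rewrite c_terms.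
  move=> zS; apply/eqP/negP => /negP kz.
  have /= /eqP := comb (dotp y); rewrite -oppr_eq0 -sumrN big_seq psumr_eq0.
    move=> /allP/(_ z zS); rewrite zS /= oppr_eq0 mulf_eq0 (negPf kz) subr_eq0.
    by rewrite lt_eqF ?y_terms.
  move=> w wS; rewrite -mulrN opprB.
  have [->|kw] := eqVneq (k w) 0; first by rewrite mul0r.
  by rewrite mulr_ge0 ?k_ge0// subr_ge0 ltW ?y_terms.
move: k_sum; rewrite big_seq big1// => /eqP.
by rewrite eq_sym oner_eq0.
Qed.

End LinearForms.

Lemma approx_at_neq0 {R : realType} {xi : R} {a b : nat}
    (n : 'I_(size (best_approx_list xi a b))) :
  (0 < (approx_at n).1 + (approx_at n).2)%N.
Proof.
have : approx_at n \in best_approx_list xi a b by rewrite mem_nth.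
rewrite mem_filter => /andP[/asboolP best_n _].
have [n_neq0 _] : calG (approx_at n) by case: best_n => -[].
by move: n_neq0; case: (approx_at n) => -[|?] [|?].
Qed.

(** Adding the two rows of the equation bounds (a_n + b_n) x_n by a + b, and a_n + b_n >= 1, so
    every coordinate is a natural number at most a + b. *)
Lemma finite_calV (R : realType) (xi : R) (a b : nat) :
  finite_set (@calV R xi a b).
Proof.
set N := size (best_approx_list xi a b).
pose F (f : {ffun 'I_N -> 'I_(a + b).+1}) : 'cV[R]_N := \col_n (f n : nat)%:R.
apply: (@sub_finite_set _ _ (F @` setT)); last exact: finite_image.
move=> x [x_nat TxE].
have x_ge0 n : 0 <= x n 0 by rewrite natr_ge0.
have x_le n : x n 0 <= (a + b)%:R.
  have := approx_at_neq0 n; set u := approx_at n => u_gt0.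
  have rowE i : \sum_m T_alpha xi a b i m * x m 0 = (if i == 0 then a else b)%:R.
    by move/matrixP: TxE => /(_ i 0); rewrite !mxE.
  have le_row i : T_alpha xi a b i n * x n 0 <= (if i == 0 then a else b)%:R.
    rewrite -rowE (bigD1 n)//= lerDl sumr_ge0// => m _.
    by rewrite mulr_ge0// mxE.
  apply: (@le_trans _ _ ((u.1 + u.2)%:R * x n 0)).
    by rewrite ler_peMl// ler1n.
  have := lerD (le_row 0) (le_row 1); rewrite !mxE /= -mulrDl -!natrD.
  exact.
(* The bound [x_le] keeps [inord] away from its default value. *)
exists [ffun n => inord (Num.truncn (x n 0))] => //.
apply/matrixP => n j; rewrite ord1 mxE ffunE.
rewrite inordK ?truncnK// ltnS.
by rewrite -(@ler_nat R) truncnK.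
Qed.

Theorem theorem4p8 (R : realType) (p q : nat) (xi : R) (a b : nat)
  (p_prime : prime p) (q_prime : prime q) (lt_pq : (p < q)%N)
  (xiE : xi = ln q%:R / ln p%:R)
  (ab_best : best_approx xi (a, b))
  (S : set 'cV[R]_(size (best_approx_list xi a b)))
  (S_inf : infimum_set p q S) :
  infimum_set p q (Vert S).
Proof.
have [SV Smin] := S_inf.
have VertS : Vert S `<=` S by move=> x [].
split=> [x /VertS/SV//|t t_gt0].
have [[x Sx fxE] lbS] := Smin t t_gt0.
(* The lower bound passes to subsets; only attainment on [Vert S] needs an argument. *)
have lbV : lbound [set f_pt p q x t | x in Vert S]
    (metric_mahler t (ratr (frac_pq p q (a, b)))).
  by move=> _ [y /VertS Sy <-]; apply: lbS; exists y.
split=> //.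
pose c : 'cV[R]_(size (best_approx_list xi a b)) :=
  \col_n mahler_rat R (frac_pq p q (approx_at n)) `^ t.
have fE y : f_pt p q y t = dotp c y `^ t^-1.
  by congr (_ `^ _); apply: eq_bigr => n _; rewrite mxE.
(* Taking the power [t^-1] is monotone on nonnegative reals. *)
have dotp_ge0 y : S y -> dotp c y \is Num.nneg.
  move=> /SV[y_nat _]; rewrite nnegrE sumr_ge0// => n _.
  by rewrite mxE mulr_ge0 ?powR_ge0 ?natr_ge0.
have finS : finite_set S by apply: sub_finite_set SV (finite_calV _ _ _ _).
have [y Vy le_yx] := Vert_argmin S c x finS Sx.
(* The value at [y] is at most the one at [x], which equals the infimum. The vertex [y] may vary
   with [t]. *)
exists y => //; apply/le_anti/andP; split; last by apply: lbV; exists y.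
rewrite -fxE !fE ge0_ler_powR ?invr_ge0 ?dotp_ge0//; first exact: ltW.
exact: VertS.
Qed.
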